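(* There is a positive constant $C$ such that for all (possibly partial) functions $f:\mathcal{S}\to\mathcal{Z}$ with $\mathcal{S}\subseteq\mathcal{X}\times\mathcal{Y}$, all $\varepsilon,\delta\in(0,\tfrac12]$, and all probability distributions $\mu$ on $\mathcal{X}\times\mathcal{Y}$, $$\mathrm{IC}_\mu(f,\varepsilon)\;\ge\;\frac{\delta^2}{C}\Big(\log_2 \overline{\mathrm{prt}}^{\mu}_{\varepsilon+3\delta}(f)-\log_2|\mathcal{Z}|\Big)-\delta .$$
   Context: $\mathcal{X},\mathcal{Y},\mathcal{Z}$ are finite sets, $\mathcal{S}\subseteq\mathcal{X}\times\mathcal{Y}$ is the set of valid inputs (the promise), and $f:\mathcal{S}\to\mathcal{Z}$. A rectangle is a set $A\times B$ with $A\subseteq\mathcal{X}$, $B\subseteq\mathcal{Y}$ (the empty rectangle included). Communication protocols are two-party randomized protocols (public and private coins allowed); $\pi(x,y)$ denotes the output. The transcript $\Pi$ consists of all exchanged messages, the public coins and the output (not the private coins). For $(x,y)\in\mathcal{S}$ let $\mathrm{err}_f(\pi;x,y)=\Pr[\pi(x,y)\ne f(x,y)]$, and $\mathrm{err}_f(\pi;x,y)=0$ for $(x,y)\notin\mathcal{S}$; $\mathrm{err}_f(\pi;\mu)=\mathbb{E}_{(X,Y)\sim\mu}\mathrm{err}_f(\pi;X,Y)$. Information complexity: with $(X,Y)\sim\mu$ and $\Pi$ the transcript of $\pi$ on $(X,Y)$, $\mathrm{IC}_\mu(\pi)=I(X;\Pi\mid Y)+I(Y;\Pi\mid X)$, and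 $\mathrm{IC}_\mu(f,\varepsilon)=\inf_{\pi:\ \mathrm{err}_f(\pi;\mu)\le\varepsilon}\mathrm{IC}_\mu(\pi)$. Relaxed partition bound: for a distribution $\mu$ on $\mathcal{X}\times\mathcal{Y}$, $\overline{\mathrm{prt}}^\mu_\varepsilon(f)$ is the value of the linear program: minimize $1/\eta$ over $\eta>0$ and $p_{R,z}\ge 0$ ($R$ ranging over all rectangles, $z\in\mathcal{Z}$) subject to (i) $\sum_{(x,y)\in\mathcal{S}}\mu(x,y)\sum_{R\ni(x,y)}p_{R,f(x,y)}+\sum_{(x,y)\notin\mathcal{S}}\mu(x,y)\sum_{z,\,R\ni(x,y)}p_{R,z}\ge(1-\varepsilon)\eta$; (ii) for all $(x,y)\in\mathcal{X}\times\mathcal{Y}$: $\sum_{z,\,R\ni(x,y)}p_{R,z}\le\eta$; (iii) $\sum_{R,z}p_{R,z}=1$. Also $\overline{\mathrm{prt}}_\varepsilon(f)=\max_\mu\overline{\mathrm{prt}}^\mu_\varepsilon(f)$. *)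

(* Defs.v *)
From Stdlib Require Import Reals List Bool.
Import ListNotations.
Open Scope R_scope.
Set Implicit Arguments.

Record FinT : Type := mkFinT {
  ft :> Type;
  ft_elems : list ft;
  ft_nodup : NoDup ft_elems;
  ft_full : forall x, In x ft_elems;
  ft_dec : forall a b : ft, {a = b} + {a <> b} }.

Definition sumR (l : list R) : R := fold_right Rplus 0 l.
Definition sumT (T : FinT) (g : T -> R) : R := sumR (map g (ft_elems T)).
Definition card (T : FinT) : R := INR (length (ft_elems T)).

Definition log2 (r : R) : R := ln r / ln 2.

(** Randomized two-party protocols, as finite protocol trees.
    - [PAlice l]: Alice speaks; child i (message i) is chosen with probability
      [fst (nth i l) x] (private coins of Alice, depending on her input x
      and implicitly on the history = position in the tree);
    - [PBob l]: same for Bob with input y;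
    - [PPub l]: a public coin; child i chosen with probability [fst (nth i l)];
    - [PLeaf z]: the protocol halts and outputs z. *)
Inductive proto (X Y Z : Type) : Type :=
| PLeaf : Z -> proto X Y Z
| PAlice : list ((X -> R) * proto X Y Z) -> proto X Y Z
| PBob : list ((Y -> R) * proto X Y Z) -> proto X Y Z
| PPub : list (R * proto X Y Z) -> proto X Y Z.
Arguments PLeaf {X Y Z}.
Arguments PAlice {X Y Z}.
Arguments PBob {X Y Z}.
Arguments PPub {X Y Z}.

Inductive valid {X Y Z : Type} : proto X Y Z -> Prop :=
| vLeaf z : valid (PLeaf z)
| vAlice (l : list ((X -> R) * proto X Y Z)) :
    (forall x, sumR (map (fun c => fst c x) l) = 1) ->
    (forall c x, In c l -> 0 <= fst c x) ->
    (forall c, In c l -> valid (snd c)) -> valid (PAlice l)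
| vBob (l : list ((Y -> R) * proto X Y Z)) :
    (forall y, sumR (map (fun c => fst c y) l) = 1) ->
    (forall c y, In c l -> 0 <= fst c y) ->
    (forall c, In c l -> valid (snd c)) -> valid (PBob l)
| vPub (l : list (R * proto X Y Z)) :
    sumR (map (fun c => fst c) l) = 1 ->
    (forall c, In c l -> 0 <= fst c) ->
    (forall c, In c l -> valid (snd c)) -> valid (PPub l).

(** All runs of the protocol on input (x,y): (transcript path, probability, output).
    The transcript is the sequence of messages (child indices), public coins
    included; the output is a function of it. *)
Fixpoint runs {X Y Z : Type} (p : proto X Y Z) (x : X) (y : Y)
  : list (list nat * R * Z) :=
  match p with
  | PLeaf z => [([], 1, z)]
  | PAlice l =>
      (fix go (l : list ((X -> R) * proto X Y Z)) (i : nat) :=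
         match l with
         | [] => []
         | (w, q) :: l' =>
             map (fun e => (i :: fst (fst e), w x * snd (fst e), snd e)) (runs q x y)
             ++ go l' (S i)
         end) l 0%nat
  | PBob l =>
      (fix go (l : list ((Y -> R) * proto X Y Z)) (i : nat) :=
         match l with
         | [] => []
         | (w, q) :: l' =>
             map (fun e => (i :: fst (fst e), w y * snd (fst e), snd e)) (runs q x y)
             ++ go l' (S i)
         end) l 0%nat
  | PPub l =>
      (fix go (l : list (R * proto X Y Z)) (i : nat) :=
         match l with
         | [] => []
         | (w, q) :: l' =>
             map (fun e => (i :: fst (fst e), w * snd (fst e), snd e)) (runs q x y)
             ++ go l' (S i)
         end) l 0%nat
  end.

Fixpoint paths {X Y Z : Type} (p : proto X Y Z) : list (list nat) :=
  match p with
  | PLeaf _ => [[]]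
  | PAlice l =>
      (fix go (l : list ((X -> R) * proto X Y Z)) (i : nat) :=
         match l with
         | [] => []
         | (_, q) :: l' => map (cons i) (paths q) ++ go l' (S i)
         end) l 0%nat
  | PBob l =>
      (fix go (l : list ((Y -> R) * proto X Y Z)) (i : nat) :=
         match l with
         | [] => []
         | (_, q) :: l' => map (cons i) (paths q) ++ go l' (S i)
         end) l 0%nat
  | PPub l =>
      (fix go (l : list (R * proto X Y Z)) (i : nat) :=
         match l with
         | [] => []
         | (_, q) :: l' => map (cons i) (paths q) ++ go l' (S i)
         end) l 0%nat
  end.

Definition Ptr {X Y Z : Type} (p : proto X Y Z) (x : X) (y : Y) (t : list nat) : R :=
  sumR (map (fun e => if list_eq_dec Nat.eq_dec t (fst (fst e)) then snd (fst e) else 0)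
            (runs p x y)).

Definition is_dist {X Y : FinT} (mu : X -> Y -> R) : Prop :=
  (forall x y, 0 <= mu x y) /\ sumT X (fun x => sumT Y (fun y => mu x y)) = 1.

(** j * log2 r, with the convention 0 * log 0 = 0 (term vanishes when j = 0). *)
Definition plog (j r : R) : R := if Rle_dec j 0 then 0 else j * log2 r.

Section IC.
Context {X Y Z : FinT} (mu : X -> Y -> R) (p : proto X Y Z).

Definition Jnt (x : X) (y : Y) (t : list nat) : R := mu x y * Ptr p x y t.
Definition sumPaths (g : list nat -> R) : R := sumR (map g (paths p)).
Definition PX (x : X) : R := sumT Y (fun y => mu x y).
Definition PY (y : Y) : R := sumT X (fun x => mu x y).
Definition PXT (x : X) (t : list nat) : R := sumT Y (fun y => Jnt x y t).
Definition PYT (y : Y) (t : list nat) : R := sumT X (fun x => Jnt x y t).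

Definition MI_X_T_given_Y : R :=
  sumT X (fun x => sumT Y (fun y => sumPaths (fun t =>
    plog (Jnt x y t) (Jnt x y t * PY y / (mu x y * PYT y t))))).
Definition MI_Y_T_given_X : R :=
  sumT X (fun x => sumT Y (fun y => sumPaths (fun t =>
    plog (Jnt x y t) (Jnt x y t * PX x / (mu x y * PXT x t))))).

Definition IC : R := MI_X_T_given_Y + MI_Y_T_given_X.
End IC.

(** Error: the partial function f has domain S = {(x,y) | f x y <> None}. *)
Definition err_pt {X Y Z : FinT} (f : X -> Y -> option Z) (p : proto X Y Z)
  (x : X) (y : Y) : R :=
  match f x y with
  | Some z => sumR (map (fun e => if ft_dec Z (snd e) z then 0 else snd (fst e)) (runs p x y))
  | None => 0
  end.
Definition err {X Y Z : FinT} (f : X -> Y -> option Z) (p : proto X Y Z)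
  (mu : X -> Y -> R) : R :=
  sumT X (fun x => sumT Y (fun y => mu x y * err_pt f p x y)).

(** Relaxed partition bound.  A rectangle A x B is given by the indicator
    functions of A and B.  The LP variables (p_{R,z}) are given as a finite list
    of weighted entries (A, B, z, w) (repeated entries add up). *)
Definition rz_entry (X Y Z : Type) : Type := ((X -> bool) * (Y -> bool) * Z * R)%type.

Definition cover_all {X Y Z : FinT} (L : list (rz_entry X Y Z)) (x : X) (y : Y) : R :=
  sumR (map (fun e => let '(A, B, _, w) := e in if andb (A x) (B y) then w else 0) L).
Definition cover_z {X Y Z : FinT} (L : list (rz_entry X Y Z)) (x : X) (y : Y) (z : Z) : R :=
  sumR (map (fun e => let '(A, B, z', w) := e in
                      if andb (A x) (B y) then (if ft_dec Z z' z then w else 0) else 0) L).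

Definition prt_feasible {X Y Z : FinT} (f : X -> Y -> option Z) (mu : X -> Y -> R)
  (eps : R) (eta : R) (L : list (rz_entry X Y Z)) : Prop :=
  0 < eta /\
  (forall A B z w, In (A, B, z, w) L -> 0 <= w) /\
  sumT X (fun x => sumT Y (fun y =>
     mu x y * match f x y with
              | Some z => cover_z L x y z
              | None => cover_all L x y
              end)) >= (1 - eps) * eta /\
  (forall x y, cover_all L x y <= eta) /\
  sumR (map (fun e => let '(_, _, _, w) := e in w) L) = 1.

Definition prt_vals {X Y Z : FinT} (f : X -> Y -> option Z) (mu : X -> Y -> R)
  (eps : R) (v : R) : Prop :=
  exists eta L, prt_feasible f mu eps eta L /\ v = / eta.

Definition is_inf (P : R -> Prop) (m : R) : Prop :=
  (forall r, P r -> m <= r) /\ (forall m', (forall r, P r -> m' <= r) -> m' <= m).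

(* Main.v *)
Require Import Defs.
From Stdlib Require Import Reals List Lra Lia Bool.
Import ListNotations.
Open Scope R_scope.

(** A transcript [t] has probability [a x t * b y t] on input [(x, y)].  Bob's
    conditional expectation [a' y t] of [a x t] given [y] is such that
    [log (a / a')] has expectation [I(X; T | Y)], and symmetrically for Alice's
    guess [b'] of [b].  With [log c = (IC + 4) / delta], Markov's inequality shows that
    outside an event of probability [delta] one has [a <= c a'] and [b <= c b'].
    For uniform thresholds [s] and [r], Alice accepts [(t, s, r)] when [s <= a] and
    [r <= c b'], Bob when [s <= c a'] and [r <= b]: each party accepts with total mass at most
    [c], and both accept with mass [min(a, c a') * min(b, c b')], which is [a b] outside
    the exceptional event.  Given a uniformly random output [z] and a random sparse set of
    triples labelled [z], of density [delta / c^2], the inputs whose owner accepts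
    some triple of the set form a rectangle; both parties accepting is
    then almost always due to a common triple, so that these rectangles are feasible with
    [1 / eta <= |Z| c^2 / delta]. *)

(** * Finite sums over lists *)

Definition lsum {A : Type} (l : list A) (g : A -> R) : R := sumR (map g l).

Lemma lsum_nil A (g : A -> R) : lsum [] g = 0.
Proof. reflexivity. Qed.

Lemma lsum_cons A (a : A) l g : lsum (a :: l) g = g a + lsum l g.
Proof. reflexivity. Qed.

Lemma lsum_ext A (l : list A) f g :
  (forall a, In a l -> f a = g a) -> lsum l f = lsum l g.
Proof.
induction l as [|a l IH]; intros H; [reflexivity|].
rewrite !lsum_cons, (H a (or_introl eq_refl)), IH; [reflexivity|].
intros b Hb; apply H; right; exact Hb.
Qed.

Lemma lsum_le A (l : list A) f g :
  (forall a, In a l -> f a <= g a) -> lsum l f <= lsum l g.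
Proof.
induction l as [|a l IH]; intros H; [apply Rle_refl|].
rewrite !lsum_cons; apply Rplus_le_compat; [apply H; left; reflexivity|].
apply IH; intros b Hb; apply H; right; exact Hb.
Qed.

Lemma lsum_0 A (l : list A) : lsum l (fun _ => 0) = 0.
Proof. induction l as [|a l IH]; [reflexivity|]. rewrite lsum_cons, IH; lra. Qed.

Lemma lsum_nonneg A (l : list A) f : (forall a, In a l -> 0 <= f a) -> 0 <= lsum l f.
Proof. intros H; rewrite <- (lsum_0 A l); apply lsum_le, H. Qed.

Lemma lsum_plus A (l : list A) f g :
  lsum l (fun a => f a + g a) = lsum l f + lsum l g.
Proof. induction l as [|a l IH]; [rewrite ?lsum_nil; lra|]. rewrite !lsum_cons, IH; lra. Qed.

Lemma lsum_minus A (l : list A) f g :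
  lsum l (fun a => f a - g a) = lsum l f - lsum l g.
Proof. induction l as [|a l IH]; [rewrite ?lsum_nil; lra|]. rewrite !lsum_cons, IH; lra. Qed.

Lemma lsum_scal A (l : list A) k f : lsum l (fun a => k * f a) = k * lsum l f.
Proof. induction l as [|a l IH]; [rewrite ?lsum_nil; lra|]. rewrite !lsum_cons, IH; lra. Qed.

Lemma lsum_scal_r A (l : list A) k f : lsum l (fun a => f a * k) = lsum l f * k.
Proof. induction l as [|a l IH]; [rewrite ?lsum_nil; lra|]. rewrite !lsum_cons, IH; lra. Qed.

Lemma lsum_const A (l : list A) k : lsum l (fun _ => k) = INR (length l) * k.
Proof.
induction l as [|a l IH]; [cbn [length]; rewrite lsum_nil; simpl; lra|].
rewrite lsum_cons, IH; cbn [length]; rewrite S_INR; lra.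
Qed.

Lemma lsum_app A (l m : list A) f : lsum (l ++ m) f = lsum l f + lsum m f.
Proof. induction l as [|a l IH]; [cbn [app]; rewrite lsum_nil; lra|]. cbn [app]; rewrite !lsum_cons, IH; lra. Qed.

Lemma lsum_map A B (h : A -> B) l f : lsum (map h l) f = lsum l (fun a => f (h a)).
Proof. unfold lsum; rewrite map_map; reflexivity. Qed.

Lemma lsum_flat_map A B (F : A -> list B) l f :
  lsum (flat_map F l) f = lsum l (fun a => lsum (F a) f).
Proof.
induction l as [|a l IH]; [reflexivity|].
cbn [flat_map]; rewrite lsum_app, lsum_cons, IH; reflexivity.
Qed.

Lemma lsum_filter A (P : A -> bool) l f :
  lsum (filter P l) f = lsum l (fun a => if P a then f a else 0).
Proof.
induction l as [|a l IH]; [reflexivity|].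
rewrite lsum_cons; cbn [filter]; destruct (P a); [rewrite lsum_cons|]; rewrite IH; lra.
Qed.

Lemma lsum_swap A B (l : list A) (m : list B) f :
  lsum l (fun a => lsum m (fun b => f a b)) = lsum m (fun b => lsum l (fun a => f a b)).
Proof.
induction l as [|a l IH]; [rewrite lsum_nil; symmetry; apply lsum_0|].
rewrite lsum_cons, IH, <- lsum_plus; apply lsum_ext; intros b _; reflexivity.
Qed.

Lemma lsum_term_le A (l : list A) f a :
  (forall b, In b l -> 0 <= f b) -> In a l -> f a <= lsum l f.
Proof.
induction l as [|b l IH]; intros H Ha; [destruct Ha|].
assert (H0 : 0 <= lsum l f) by (apply lsum_nonneg; intros; apply H; right; assumption).
rewrite lsum_cons; destruct Ha as [<-|Ha]; [lra|].
assert (0 <= f b) by (apply H; left; reflexivity).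
assert (f a <= lsum l f); [|lra].
apply IH; [intros; apply H; right|]; assumption.
Qed.

(** Elements are compared through a key with decidable equality, so that leaves, which contain
    functions, can be singled out by their paths. *)
Lemma lsum_delta A K (dec : forall a b : K, {a = b} + {a <> b}) (k : A -> K) l f a :
  NoDup (map k l) -> In a l ->
  lsum l (fun b => if dec (k a) (k b) then f b else 0) = f a.
Proof.
induction l as [|b l IH]; intros Hn Ha; [destruct Ha|].
cbn in Hn; apply NoDup_cons_iff in Hn as [Hb Hn].
rewrite lsum_cons; destruct Ha as [->|Ha].
- destruct (dec (k a) (k a)) as [_|]; [|contradiction].
  rewrite (lsum_ext _ l _ (fun _ => 0)), lsum_0; [lra|].
  intros c Hc; destruct (dec (k a) (k c)) as [e|]; [|reflexivity].
  exfalso; apply Hb; rewrite e; apply in_map, Hc.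
- destruct (dec (k a) (k b)) as [e|_].
  + exfalso; apply Hb; rewrite <- e; apply in_map, Ha.
  + rewrite IH by assumption; lra.
Qed.

Lemma lsum_delta_FinT (T : FinT) (f : T -> R) a :
  lsum (ft_elems T) (fun b => if ft_dec T a b then f b else 0) = f a.
Proof.
apply (lsum_delta T T (ft_dec T) (fun t => t)); [rewrite map_id; apply ft_nodup|apply ft_full].
Qed.

(** * Real-valued indicators *)

Definition ind (b : bool) : R := if b then 1 else 0.

Lemma ind_bounds b : 0 <= ind b <= 1.
Proof. destruct b; cbn; lra. Qed.

Lemma if_ind (b : bool) r : (if b then r else 0) = r * ind b.
Proof. destruct b; cbn; lra. Qed.

Lemma ind_and a b : ind (a && b) = ind a * ind b.
Proof. destruct a, b; cbn; lra. Qed.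

(** * Random subsets *)

(** The subsets of [U] with their probabilities, when every element is kept
    independently with its own probability. *)
Fixpoint subsets {E : Type} (U : list (E * R)) : list (list E * R) :=
  match U with
  | [] => [([], 1)]
  | (u, w) :: U' =>
      map (fun s => (u :: fst s, w * snd s)) (subsets U')
      ++ map (fun s => (fst s, (1 - w) * snd s)) (subsets U')
  end.

Definition expect {E : Type} (U : list (E * R)) (F : list E -> R) : R :=
  lsum (subsets U) (fun s => snd s * F (fst s)).

Lemma expect_nil E (F : list E -> R) : expect [] F = F [].
Proof. unfold expect, lsum; cbn; lra. Qed.

Lemma expect_cons E u w (U : list (E * R)) F :
  expect ((u, w) :: U) F = w * expect U (fun s => F (u :: s)) + (1 - w) * expect U F.
Proof.
unfold expect; cbn [subsets]; rewrite lsum_app, !lsum_map; cbn [fst snd].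
rewrite <- !lsum_scal; f_equal; apply lsum_ext; intros s _; ring.
Qed.

Lemma expect_1 E (U : list (E * R)) : expect U (fun _ => 1) = 1.
Proof.
induction U as [|[u w] U IH]; [apply expect_nil|]. rewrite expect_cons, IH; ring.
Qed.

Lemma subsets_nonneg E (U : list (E * R)) :
  (forall e, In e U -> 0 <= snd e <= 1) -> forall s, In s (subsets U) -> 0 <= snd s.
Proof.
induction U as [|[u w] U IH]; intros H s; cbn.
- intros [<-|[]]; cbn; lra.
- assert (Hw : 0 <= w <= 1) by (apply (H (u, w)); left; reflexivity).
  assert (IH' := IH (fun e He => H e (or_intror He))).
  rewrite in_app_iff, !in_map_iff; intros [[s' [<- Hs]]|[s' [<- Hs]]]; cbn;
  apply Rmult_le_pos; try lra; apply IH', Hs.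
Qed.

Lemma expect_le E (U : list (E * R)) F G :
  (forall e, In e U -> 0 <= snd e <= 1) -> (forall s, F s <= G s) ->
  expect U F <= expect U G.
Proof.
intros H HFG; apply lsum_le; intros s Hs; apply Rmult_le_compat_l; [|apply HFG].
apply (subsets_nonneg _ U H s Hs).
Qed.

(** Union bound over the sampled elements. *)
Lemma expect_hit_le E (U : list (E * R)) (al : E -> bool) :
  (forall e, In e U -> 0 <= snd e <= 1) ->
  0 <= expect U (fun s => ind (existsb al s)) <= lsum U (fun e => snd e * ind (al (fst e))).
Proof.
induction U as [|[u w] U IH]; intros H.
- rewrite expect_nil, !lsum_nil; simpl; lra.
- assert (Hw : 0 <= w <= 1) by (apply (H (u, w)); left; reflexivity).
  specialize (IH (fun e He => H e (or_intror He))).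
  rewrite expect_cons, lsum_cons; cbn [fst snd existsb].
  destruct (al u); cbn [orb].
  + change (ind true) with 1; rewrite expect_1.
    set (e := expect U _) in *.
    assert (0 <= w * e) by (apply Rmult_le_pos; lra).
    assert (0 <= (1 - w) * e) by (apply Rmult_le_pos; lra). lra.
  + change (ind false) with 0. lra.
Qed.

(** A sample meets both predicates through a common element, of expected number [j], or through two
    distinct elements, which independence bounds by [a * b]. The lower bound is a weak Bonferroni
    inequality for common elements. The induction conditions on whether the first element is
    kept. *)
Lemma expect_hit_both E (U : list (E * R)) (al be : E -> bool) :
  (forall e, In e U -> 0 <= snd e <= 1) ->
  let j := lsum U (fun e => snd e * ind (al (fst e) && be (fst e))) in
  let a := lsum U (fun e => snd e * ind (al (fst e))) in
  let b := lsum U (fun e => snd e * ind (be (fst e))) in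
  j - j * j <= expect U (fun s => ind (existsb al s && existsb be s)) <= j + a * b.
Proof.
induction U as [|[u w] U IH]; intros H; cbv zeta.
- rewrite expect_nil, !lsum_nil; simpl; lra.
- assert (Hw : 0 <= w <= 1) by (apply (H (u, w)); left; reflexivity).
  assert (HU := fun e He => H e (or_intror He) : 0 <= snd e <= 1).
  specialize (IH HU); cbv zeta in IH.
  assert (Ha := expect_hit_le _ U al HU). assert (Hb := expect_hit_le _ U be HU).
  assert (Hja : expect U (fun s => ind (existsb al s && existsb be s))
                <= expect U (fun s => ind (existsb al s))).
  { apply expect_le; [exact HU|]; intros s; rewrite ind_and.
    assert (A := ind_bounds (existsb al s)); assert (B := ind_bounds (existsb be s)); nra. }
  assert (Hjb : expect U (fun s => ind (existsb al s && existsb be s))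
                <= expect U (fun s => ind (existsb be s))).
  { apply expect_le; [exact HU|]; intros s; rewrite ind_and.
    assert (A := ind_bounds (existsb al s)); assert (B := ind_bounds (existsb be s)); nra. }
  assert (Hh : 0 <= expect U (fun s => ind (existsb al s && existsb be s))).
  { apply lsum_nonneg; intros s Hs; apply Rmult_le_pos; [|apply ind_bounds].
    apply (subsets_nonneg _ U HU s Hs). }
  assert (Hj : 0 <= lsum U (fun e => snd e * ind (al (fst e) && be (fst e)))).
  { apply lsum_nonneg; intros e He; apply Rmult_le_pos; [apply HU, He|apply ind_bounds]. }
  rewrite expect_cons, !lsum_cons; cbn [fst snd existsb].
  set (j := lsum U (fun e => snd e * ind (al (fst e) && be (fst e)))) in *.
  set (a := lsum U (fun e => snd e * ind (al (fst e)))) in *.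
  set (b := lsum U (fun e => snd e * ind (be (fst e)))) in *.
  set (h := expect U (fun s => ind (existsb al s && existsb be s))) in *.
  set (ha := expect U (fun s => ind (existsb al s))) in *.
  set (hb := expect U (fun s => ind (existsb be s))) in *.
  assert (Hab : 0 <= a * b) by (apply Rmult_le_pos; lra).
  assert (Hwa : 0 <= w * a) by (apply Rmult_le_pos; lra).
  assert (Hwb : 0 <= w * b) by (apply Rmult_le_pos; lra).
  assert (Hwh : 0 <= w * h) by (apply Rmult_le_pos; lra).
  assert (Hwj : 0 <= w * j) by (apply Rmult_le_pos; lra).
  assert (Hww : 0 <= w * w) by (apply Rmult_le_pos; lra).
  assert (Hjj : 0 <= w * (j * j)) by (apply Rmult_le_pos; [lra|apply Rmult_le_pos; lra]).
  assert (H1 : (1 - w) * (j - j * j) <= (1 - w) * h) by (apply Rmult_le_compat_l; lra).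
  assert (H2 : w * h <= w * ha) by (apply Rmult_le_compat_l; lra).
  assert (H3 : w * h <= w * hb) by (apply Rmult_le_compat_l; lra).
  assert (H4 : w * ha <= w * a) by (apply Rmult_le_compat_l; lra).
  assert (H5 : w * hb <= w * b) by (apply Rmult_le_compat_l; lra).
  (* If [u] is kept and satisfies just one predicate, the tail only has to meet the other one, which
     brings in [ha] or [hb]. *)
  destruct (al u), (be u); cbn [orb andb];
    change (ind true) with 1; change (ind false) with 0.
  + rewrite expect_1; lra.
  + fold hb; lra.
  + assert (E1 : expect U (fun s => ind (existsb al s && true)) = ha).
    { apply lsum_ext; intros s _; rewrite andb_true_r; reflexivity. }
    rewrite E1; lra.
  + fold h; lra.
Qed.

(** * Thresholds *)

Definition leb (a b : R) : bool := if Rle_dec a b then true else false.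

Lemma leb_Rmin a u v : (leb a u && leb a v)%bool = leb a (Rmin u v).
Proof.
unfold leb; destruct (Rle_dec a u) as [H1|H1], (Rle_dec a v) as [H2|H2],
  (Rle_dec a (Rmin u v)) as [H3|H3]; try reflexivity; exfalso.
- apply H3, Rmin_glb; assumption.
- apply H2; apply Rle_trans with (1 := H3), Rmin_r.
- apply H1; apply Rle_trans with (1 := H3), Rmin_l.
- apply H1; apply Rle_trans with (1 := H3), Rmin_l.
Qed.

Lemma filter_length_lt A (P : A -> bool) l a :
  In a l -> P a = false -> (length (filter P l) < length l)%nat.
Proof.
induction l as [|b l IH]; intros Ha HP; [destruct Ha|].
assert (L := filter_length_le P l); cbn; destruct Ha as [->|Ha].
- rewrite HP; lia.
- specialize (IH Ha HP); destruct (P b); cbn; lia.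
Qed.

Lemma exists_min (l : list R) : l <> [] -> exists m, In m l /\ forall v, In v l -> m <= v.
Proof.
induction l as [|a l IH]; intros H; [contradiction|].
destruct l as [|b l].
- exists a; split; [left; reflexivity|]; intros v [<-|[]]; lra.
- destruct IH as [m [Hm Hl]]; [discriminate|].
  destruct (Rle_dec a m) as [H1|H1].
  + exists a; split; [left; reflexivity|]; intros v [<-|Hv]; [lra|].
    apply Rle_trans with (1 := H1), Hl, Hv.
  + exists m; split; [right; exact Hm|]; intros v [<-|Hv]; [lra|apply Hl, Hv].
Qed.

(* The thresholds are the values themselves, each weighted by the gap to the
   preceding one, so that the sum telescopes. *)
Lemma layer_cake_from (n : nat) (l : list R) (m : R) :
  (length l <= n)%nat -> 0 <= m -> (forall v, In v l -> m <= v <= 1) ->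
  exists W : list (R * R),
    (forall e, In e W -> In (fst e) l /\ 0 <= snd e <= 1) /\
    (forall v, In v l -> lsum W (fun e => snd e * ind (leb (fst e) v)) = v - m).
Proof.
revert l m; induction n as [|n IH]; intros l m Hn H0 Hl.
{ destruct l as [|a l]; [|cbn in Hn; lia]. exists []; split; intros ? []. }
destruct l as [|a l0]; [exists []; split; intros ? []|].
destruct (exists_min (a :: l0)) as [m' [Hm' Hmin]]; [discriminate|].
remember (a :: l0) as l eqn:El.
assert (Hleb : forall v, leb v m' = true <-> v <= m').
{ intros v; unfold leb; destruct (Rle_dec v m'); split; intros; congruence || lra. }
(* Recursion on the values strictly above the minimum [m'], with [m'] as the new base level. *)
destruct (IH (filter (fun v => negb (leb v m')) l) m') as [W [HW1 HW2]].
- assert (length (filter (fun v => negb (leb v m')) l) < length l)%nat; [|lia].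
  apply filter_length_lt with m'; [exact Hm'|].
  rewrite (proj2 (Hleb m')); [reflexivity|lra].
- specialize (Hl _ Hm'); lra.
- intros v Hv; apply filter_In in Hv as [Hv _]; split; [apply Hmin, Hv|apply Hl, Hv].
- exists ((m', m' - m) :: W); split.
  + intros e [<-|He]; cbn [fst snd].
    * specialize (Hl _ Hm'); split; [exact Hm'|lra].
    * destruct (HW1 e He) as [H1 H2]; apply filter_In in H1; tauto.
  + intros v Hv; rewrite lsum_cons; cbn [fst snd].
    assert (Hmv : leb m' v = true).
    { unfold leb; destruct (Rle_dec m' v) as [|N]; [reflexivity|]. elim N; apply Hmin, Hv. }
    rewrite Hmv; cbn [ind]. destruct (leb v m') eqn:E.
    * apply Hleb in E; assert (v = m') by (apply Rle_antisym; [exact E|apply Hmin, Hv]).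
      subst v; rewrite (lsum_ext _ W _ (fun _ => 0)), lsum_0; [lra|].
      intros e He; destruct (HW1 e He) as [H1 _]; apply filter_In in H1 as [_ H1].
      rewrite (proj1 (negb_true_iff _) H1); cbn; lra.
    * rewrite HW2; [lra|]. apply filter_In; split; [exact Hv|]. rewrite E; reflexivity.
Qed.

(** A finite substitute for a uniform threshold in [[0, 1]]: finitely many thresholds suffice
    because only the values in [l] are compared with them. *)
Lemma layer_cake (l : list R) :
  (forall v, In v l -> 0 <= v <= 1) ->
  exists W : list (R * R), (forall e, In e W -> 0 <= snd e <= 1) /\
    (forall v, In v l -> lsum W (fun e => snd e * ind (leb (fst e) v)) = v).
Proof.
intros H; destruct (layer_cake_from (length l) l 0) as [W [H1 H2]]; [lia|lra|exact H|].
exists W; split; [intros e He; apply H1, He|].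
intros v Hv; rewrite (H2 v Hv); lra.
Qed.

(** * Families of labelled rectangles *)

Definition wt {X Y Z : Type} (e : rz_entry X Y Z) : R := snd e.
Definition lab {X Y Z : Type} (e : rz_entry X Y Z) : Z := snd (fst e).
Definition side_X {X Y Z : Type} (e : rz_entry X Y Z) : X -> bool := fst (fst (fst e)).
Definition side_Y {X Y Z : Type} (e : rz_entry X Y Z) : Y -> bool := snd (fst (fst e)).

(** The left side of the correctness constraint in [prt_feasible], separated out so that it applies
    to families whose weights need not sum to 1. *)
Definition success {X Y Z : FinT} (f : X -> Y -> option Z) (mu : X -> Y -> R)
  (L : list (rz_entry X Y Z)) : R :=
  sumT X (fun x => sumT Y (fun y =>
     mu x y * match f x y with
              | Some z => cover_z L x y z
              | None => cover_all L x y
              end)).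

Section Families.
Context {X Y Z : FinT}.
Implicit Types (U : list (rz_entry X Y Z)) (x : X) (y : Y) (z : Z).

Lemma cover_all_lsum U x y :
  cover_all U x y = lsum U (fun e => wt e * ind (side_X e x && side_Y e y)).
Proof. apply lsum_ext; intros [[[A B] z] w] _; apply if_ind. Qed.

Lemma cover_z_lsum U x y z :
  cover_z U x y z =
  lsum U (fun e => if ft_dec Z (lab e) z then wt e * ind (side_X e x && side_Y e y) else 0).
Proof.
apply lsum_ext; intros [[[A B] z'] w] _; unfold lab, wt, side_X, side_Y; cbn.
destruct (A x && B y)%bool, (ft_dec Z z' z); cbn; lra.
Qed.

Lemma cover_all_sum_z U x y : cover_all U x y = lsum (ft_elems Z) (fun z => cover_z U x y z).
Proof.
rewrite cover_all_lsum, (lsum_ext _ _ _ _ (fun z _ => cover_z_lsum U x y z)), lsum_swap.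
apply lsum_ext; intros e _. symmetry; apply (lsum_delta_FinT Z (fun _ => _)).
Qed.

Definition with_label U (lam : R) z : list (rz_entry X Y Z * R) :=
  map (fun e => (e, lam * wt e)) (filter (fun e => if ft_dec Z (lab e) z then true else false) U).

(** The sides are unions over the sample, so each entry is again a rectangle, at the price of
    covering some [(x, y)] that lie in no single sampled rectangle. *)
Definition hitting U (lam : R) : list (rz_entry X Y Z) :=
  flat_map (fun z => map (fun s =>
      ((fun x => existsb (fun e => side_X e x) (fst s)),
       (fun y => existsb (fun e => side_Y e y) (fst s)), z, / card Z * snd s))
    (subsets (with_label U lam z))) (ft_elems Z).

Lemma with_label_lsum U lam z (g : rz_entry X Y Z -> R) :
  lsum (with_label U lam z) (fun e => snd e * g (fst e)) =
  lam * lsum U (fun e => if ft_dec Z (lab e) z then wt e * g e else 0).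
Proof.
unfold with_label; rewrite lsum_map, lsum_filter, <- lsum_scal; cbn [fst snd].
apply lsum_ext; intros e _; destruct (ft_dec Z (lab e) z); lra.
Qed.

Lemma hitting_cover_z U lam x y z :
  cover_z (hitting U lam) x y z =
  / card Z * expect (with_label U lam z) (fun s =>
    ind (existsb (fun e => side_X e x) s && existsb (fun e => side_Y e y) s)).
Proof.
rewrite cover_z_lsum; unfold hitting; rewrite lsum_flat_map.
rewrite <- (lsum_delta_FinT Z (fun z => / card Z * expect (with_label U lam z) (fun s =>
    ind (existsb (fun e => side_X e x) s && existsb (fun e => side_Y e y) s))) z).
apply lsum_ext; intros z' _; rewrite lsum_map.
unfold lab, wt; cbn [fst snd].
destruct (ft_dec Z z' z) as [->|n].
- destruct (ft_dec Z z z); [|congruence].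
  unfold expect; rewrite <- lsum_scal; apply lsum_ext; intros s _.
  rewrite Rmult_assoc; reflexivity.
- destruct (ft_dec Z z z'); [congruence|]. apply lsum_0.
Qed.

Lemma hitting_total U lam : card Z > 0 ->
  sumR (map (fun e : rz_entry X Y Z => let '(_, _, _, w) := e in w) (hitting U lam)) = 1.
Proof.
intros HZ; change (lsum (hitting U lam) (fun e => let '(_, _, _, w) := e in w) = 1).
unfold hitting; rewrite lsum_flat_map.
rewrite (lsum_ext _ _ _ (fun _ => / card Z)).
- rewrite lsum_const; apply Rinv_r; unfold card in *; lra.
- intros z _; transitivity (/ card Z * expect (with_label U lam z) (fun _ => 1));
    [|rewrite expect_1; ring].
  rewrite lsum_map; unfold expect; rewrite <- lsum_scal; apply lsum_ext; intros s _; ring.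
Qed.

(* An input is covered either because one sampled rectangle contains it, which gives
   the main term, or because two different ones contain [x] and [y] respectively; the
   latter is negligible since the marginals are at most [c] and the rate is [d / c^2]. *)
Lemma hitting_feasible U f mu (c d e : R) :
  card Z > 0 -> is_dist mu -> 1 <= c -> 0 < d <= 1 -> 2 * d <= e ->
  (forall u, In u U -> 0 <= wt u <= 1) ->
  (forall x, lsum U (fun u => wt u * ind (side_X u x)) <= c) ->
  (forall y, lsum U (fun u => wt u * ind (side_Y u y)) <= c) ->
  (forall x y, cover_all U x y <= 1) ->
  1 - e + 2 * d <= success f mu U ->
  prt_feasible f mu e (/ card Z * (d / (c * c) * (1 + d))) (hitting U (d / (c * c))).
Proof.
intros HZ [Hmu Hmu1] Hc Hd He Hw HX HY Hcov Hs.
set (lam := d / (c * c)).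
assert (Hcc : 1 <= c * c) by nra.
assert (Hlam : 0 < lam) by (apply Rdiv_lt_0_compat; lra).
assert (Hlc : lam * (c * c) = d) by (unfold lam; field; lra).
assert (Hld : lam <= d) by nra.
clearbody lam.
assert (HiZ : 0 < / card Z) by (apply Rinv_0_lt_compat; exact HZ).
assert (Hwl : forall z u, In u (with_label U lam z) -> 0 <= snd u <= 1).
{ intros z u Hu; unfold with_label in Hu; apply in_map_iff in Hu as [v [<- Hv]].
  apply filter_In in Hv as [Hv _]; specialize (Hw v Hv); cbn [snd]; nra. }
assert (Hnn : forall x y z u, In u U ->
  0 <= (if ft_dec Z (lab u) z then wt u * ind (side_X u x && side_Y u y) else 0)).
{ intros x y z u Hu; destruct (ft_dec Z (lab u) z); [|lra].
  apply Rmult_le_pos; [apply Hw, Hu|apply ind_bounds]. }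
assert (Hz0 : forall x y z, 0 <= cover_z U x y z).
{ intros; rewrite cover_z_lsum; apply lsum_nonneg, Hnn. }
assert (Hz1 : forall x y z, cover_z U x y z <= 1).
{ intros x y z; apply Rle_trans with (2 := Hcov x y); rewrite cover_all_sum_z.
  apply (lsum_term_le _ _ (fun z => cover_z U x y z)); [intros; apply Hz0|apply ft_full]. }
assert (Hlow : forall x y z,
  / card Z * (lam * (1 - d)) * cover_z U x y z <= cover_z (hitting U lam) x y z).
{ intros x y z; rewrite hitting_cover_z, Rmult_assoc; apply Rmult_le_compat_l; [lra|].
  destruct (expect_hit_both _ (with_label U lam z) (fun e => side_X e x)
    (fun e => side_Y e y) (Hwl z)) as [H _].
  rewrite (with_label_lsum U lam z (fun e => ind (side_X e x && side_Y e y))),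
    <- cover_z_lsum in H.
  apply Rle_trans with (2 := H); specialize (Hz0 x y z); specialize (Hz1 x y z).
  set (q := cover_z U x y z) in *.
  (* With [j = lam * q], the loss [j * j] is at most [d * j], because [q <= 1] and [lam <= d]. *)
  assert (lam * lam * (q * q) <= lam * d * q); [|nra].
  assert (q * q <= q) by nra. assert (lam * lam <= lam * d) by nra.
  assert (0 <= lam * lam) by nra. nra. }
assert (Hup : forall x y,
  cover_all (hitting U lam) x y <= / card Z * (lam * (1 + d))).
{ intros x y; rewrite cover_all_sum_z, (lsum_ext _ _ _ _ (fun z _ => hitting_cover_z U lam x y z)),
    lsum_scal; apply Rmult_le_compat_l; [lra|].
  (* In the collision term Bob's mass is bounded by [c] for each label, while Alice's is kept, so
     that its sum over all labels is again at most [c]. The total is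
     [lam * (lam * (c * c)) = lam * d]. *)
  apply Rle_trans with (lsum (ft_elems Z) (fun z => lam * cover_z U x y z +
     lsum U (fun u => if ft_dec Z (lab u) z then wt u * ind (side_X u x) else 0)
       * (lam * (lam * c)))).
  - apply lsum_le; intros z _.
    destruct (expect_hit_both _ (with_label U lam z) (fun e => side_X e x)
      (fun e => side_Y e y) (Hwl z)) as [_ H].
    rewrite (with_label_lsum U lam z (fun e => ind (side_X e x && side_Y e y))),
      <- cover_z_lsum, (with_label_lsum U lam z (fun e => ind (side_X e x))),
      (with_label_lsum U lam z (fun e => ind (side_Y e y))) in H.
    apply Rle_trans with (1 := H); apply Rplus_le_compat_l.
    set (a := lsum U _); set (b := lsum U _).
    assert (0 <= a).
    { apply lsum_nonneg; intros u Hu; destruct (ft_dec Z (lab u) z); [|lra].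
      apply Rmult_le_pos; [apply Hw, Hu|apply ind_bounds]. }
    assert (b <= c).
    { apply Rle_trans with (2 := HY y); apply lsum_le; intros u Hu.
      assert (0 <= wt u * ind (side_Y u y))
        by (apply Rmult_le_pos; [apply Hw, Hu|apply ind_bounds]).
      destruct (ft_dec Z (lab u) z); lra. }
    replace (lam * a * (lam * b)) with (a * (lam * (lam * b))) by ring.
    repeat apply Rmult_le_compat_l; lra.
  - rewrite lsum_plus, lsum_scal, lsum_scal_r, <- cover_all_sum_z, lsum_swap.
    rewrite (lsum_ext _ U _ (fun u => wt u * ind (side_X u x)))
      by (intros u _; apply (lsum_delta_FinT Z (fun _ => _))).
    specialize (HX x); specialize (Hcov x y); set (a := lsum U _) in *.
    assert (lam * cover_all U x y <= lam * 1) by (apply Rmult_le_compat_l; lra).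
    assert (a * (lam * (lam * c)) <= c * (lam * (lam * c))).
    { apply Rmult_le_compat_r; [|lra]. repeat apply Rmult_le_pos; lra. }
    replace (c * (lam * (lam * c))) with (lam * (lam * (c * c))) in * by ring.
    rewrite Hlc in *; lra. }
split; [|split; [|split; [|split]]].
- apply Rmult_lt_0_compat; [lra|apply Rmult_lt_0_compat; lra].
- intros A B z w Hin; unfold hitting in Hin; apply in_flat_map in Hin as [z' [_ Hin]].
  apply in_map_iff in Hin as [s [Es Hs']]; injection Es as _ _ _ <-.
  apply Rmult_le_pos; [lra|]. apply (subsets_nonneg _ _ (Hwl z') s Hs').
- apply Rle_ge, Rle_trans with (/ card Z * (lam * (1 - d)) * success f mu U).
  (* The right side minus the left is at least [2 * d * (e - d)]: the slack [2 * d] in the success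
     pays for the factors [1 - d] here and [1 + d] in [eta]. *)
  + assert (Hkey : (1 - e) * (1 + d) <= (1 - d) * success f mu U).
    { apply Rle_trans with ((1 - d) * (1 - e + 2 * d)).
      - assert (0 <= 2 * d * (e - d)) by (apply Rmult_le_pos; lra). lra.
      - apply Rmult_le_compat_l; lra. }
    replace ((1 - e) * (/ card Z * (lam * (1 + d))))
      with (/ card Z * lam * ((1 - e) * (1 + d))) by ring.
    replace (/ card Z * (lam * (1 - d)) * success f mu U)
      with (/ card Z * lam * ((1 - d) * success f mu U)) by ring.
    apply Rmult_le_compat_l; [|exact Hkey]. apply Rmult_le_pos; lra.
  + unfold success; change (@sumT) with (fun T : FinT => @lsum T (ft_elems T)); cbv beta.
    rewrite <- lsum_scal; apply lsum_le; intros x _.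
    rewrite <- lsum_scal; apply lsum_le; intros y _.
    rewrite <- Rmult_assoc, (Rmult_comm _ (mu x y)), Rmult_assoc.
    apply Rmult_le_compat_l; [apply Hmu|]. destruct (f x y) as [z|]; [apply Hlow|].
    rewrite !cover_all_sum_z, <- lsum_scal; apply lsum_le; intros z _; apply Hlow.
- exact Hup.
- apply hitting_total, HZ.
Qed.

End Families.

(** * Rectangles obtained by thresholding *)

(** For a fixed index and pair of thresholds, acceptance is decided separately by [x] and by [y],
    which gives a rectangle. Both parties accept when each threshold is at most the minimum of the
    two values compared with it, whence the products of [Rmin]. *)
Lemma threshold_family {X Y Z : FinT} {I : Type} (l : list I)
  (qa ca : I -> X -> R) (qb cb : I -> Y -> R) (out : I -> Z) :
  (forall i x, In i l -> 0 <= qa i x <= 1) -> (forall i x, In i l -> 0 <= ca i x <= 1) ->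
  (forall i y, In i l -> 0 <= qb i y <= 1) -> (forall i y, In i l -> 0 <= cb i y <= 1) ->
  exists U : list (rz_entry X Y Z),
    (forall u, In u U -> 0 <= wt u <= 1) /\
    (forall x, lsum U (fun u => wt u * ind (side_X u x)) = lsum l (fun i => qa i x * ca i x)) /\
    (forall y, lsum U (fun u => wt u * ind (side_Y u y)) = lsum l (fun i => cb i y * qb i y)) /\
    (forall x y z, cover_z U x y z = lsum l (fun i =>
       if ft_dec Z (out i) z then Rmin (qa i x) (cb i y) * Rmin (ca i x) (qb i y) else 0)).
Proof.
intros Hqa Hca Hqb Hcb.
set (vs := flat_map (fun i => (map (qa i) (ft_elems X) ++ map (ca i) (ft_elems X))
                 ++ (map (qb i) (ft_elems Y) ++ map (cb i) (ft_elems Y))) l).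
assert (Hvs : forall i x y, In i l ->
  In (qa i x) vs /\ In (ca i x) vs /\ In (qb i y) vs /\ In (cb i y) vs).
{ intros i x y Hi; unfold vs; repeat split; apply in_flat_map; exists i; (split; [exact Hi|]);
  rewrite !in_app_iff.
  - left; left; apply in_map, ft_full.
  - left; right; apply in_map, ft_full.
  - right; left; apply in_map, ft_full.
  - right; right; apply in_map, ft_full. }
destruct (layer_cake vs) as [W [HW HWv]].
{ intros v Hv; apply in_flat_map in Hv as [i [Hi Hv]]; rewrite !in_app_iff, !in_map_iff in Hv.
  destruct Hv as [[[x [<- _]]|[x [<- _]]]|[[y [<- _]]|[y [<- _]]]]; auto. }
assert (Hprod : forall u v, In u vs -> In v vs ->
  lsum W (fun a => lsum W (fun b =>
    snd a * snd b * ind (leb (fst a) u && leb (fst b) v))) = u * v).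
{ intros u v Hu Hv.
  transitivity (lsum W (fun a => snd a * ind (leb (fst a) u))
                * lsum W (fun b => snd b * ind (leb (fst b) v)));
    [|rewrite !HWv by assumption; reflexivity].
  rewrite <- lsum_scal_r; apply lsum_ext; intros a _; rewrite <- lsum_scal.
  apply lsum_ext; intros b _; rewrite ind_and; ring. }
(* The minimum of two listed values is one of them, so [W] also measures minima correctly. *)
assert (Hmin : forall u v, In u vs -> In v vs -> In (Rmin u v) vs).
{ intros u v Hu Hv; unfold Rmin; destruct (Rle_dec u v); assumption. }
exists (flat_map (fun i => flat_map (fun a => map (fun b =>
     ((fun x => leb (fst a) (qa i x) && leb (fst b) (ca i x))%bool,
      (fun y => leb (fst a) (cb i y) && leb (fst b) (qb i y))%bool,
      out i, snd a * snd b)) W) W) l).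
split; [|split; [|split]].
- intros u Hu; apply in_flat_map in Hu as [i [_ Hu]]; apply in_flat_map in Hu as [a [Ha Hu]].
  apply in_map_iff in Hu as [b [<- Hb]]; unfold wt; cbn [snd].
  apply HW in Ha; apply HW in Hb; split; [apply Rmult_le_pos; lra|].
  replace 1 with (1 * 1) by ring; apply Rmult_le_compat; lra.
- intros x; rewrite lsum_flat_map; apply lsum_ext; intros i Hi; rewrite lsum_flat_map.
  rewrite <- Hprod.
  + apply lsum_ext; intros a _; rewrite lsum_map; reflexivity.
  (* [Hvs] asks for some [y]; when [Y] is empty, membership is shown directly. *)
  + destruct (ft_elems Y) as [|y ys] eqn:E.
    * apply in_flat_map; exists i; split; [exact Hi|].
      rewrite !in_app_iff; left; left; apply in_map, ft_full.
    * apply (Hvs i x y Hi).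
  + destruct (ft_elems Y) as [|y ys] eqn:E.
    * apply in_flat_map; exists i; split; [exact Hi|].
      rewrite !in_app_iff; left; right; apply in_map, ft_full.
    * apply (Hvs i x y Hi).
- intros y; rewrite lsum_flat_map; apply lsum_ext; intros i Hi; rewrite lsum_flat_map.
  rewrite <- Hprod.
  + apply lsum_ext; intros a _; rewrite lsum_map; reflexivity.
  + apply in_flat_map; exists i; split; [exact Hi|].
    rewrite !in_app_iff; right; right; apply in_map, ft_full.
  + apply in_flat_map; exists i; split; [exact Hi|].
    rewrite !in_app_iff; right; left; apply in_map, ft_full.
- intros x y z; rewrite cover_z_lsum, lsum_flat_map; apply lsum_ext; intros i Hi.
  destruct (Hvs i x y Hi) as [H1 [H2 [H3 H4]]].
  rewrite lsum_flat_map; destruct (ft_dec Z (out i) z) as [e|n].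
  + rewrite <- Hprod by auto.
    apply lsum_ext; intros a _; rewrite lsum_map; apply lsum_ext; intros b _.
    unfold lab, wt, side_X, side_Y; cbn [fst snd].
    destruct (ft_dec Z (out i) z); [|contradiction].
    rewrite <- !leb_Rmin, !ind_and; ring.
  + rewrite (lsum_ext _ W _ (fun _ => 0)), lsum_0; [reflexivity|].
    intros a _; rewrite lsum_map, (lsum_ext _ W _ (fun _ => 0)), lsum_0; [reflexivity|].
    intros b _; unfold lab; cbn [fst snd]. destruct (ft_dec Z (out i) z); [contradiction|reflexivity].
Qed.

(** * Information *)

Lemma ln_ge r : 0 < r -> 1 - / r <= ln r.
Proof.
intros Hr; assert (H := exp_ineq1_le (- ln r)).
rewrite exp_Ropp, exp_ln in H by exact Hr; lra.
Qed.

Lemma log2_le a b : 0 < a -> a <= b -> log2 a <= log2 b.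
Proof.
intros Ha Hab; assert (H := ln_lt_2); unfold log2, Rdiv.
apply Rmult_le_compat_r; [left; apply Rinv_0_lt_compat; lra|].
destruct Hab as [Hab| ->]; [left; apply ln_increasing; assumption|lra].
Qed.

Lemma log2_1 : log2 1 = 0.
Proof. unfold log2; rewrite ln_1; unfold Rdiv; ring. Qed.

(** In the applications [j / r] is a reference mass, and summation gives Gibbs' inequality. *)
Lemma plog_ge j r : 0 < j -> 0 < r -> (j - j / r) / ln 2 <= plog j r.
Proof.
intros Hj Hr; unfold plog; destruct (Rle_dec j 0); [lra|].
assert (H := ln_lt_2); unfold log2, Rdiv; rewrite <- Rmult_assoc.
apply Rmult_le_compat_r; [left; apply Rinv_0_lt_compat; lra|].
assert (j * (1 - / r) <= j * ln r); [|lra].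
apply Rmult_le_compat_l; [lra|apply ln_ge, Hr].
Qed.

(** Pointwise form of Markov's inequality: the negative part of [plog j r] is at most
    [(j / r) / ln 2], which [2 * (j / r)] covers since [ln 2 > 1 / 2]. *)
Lemma plog_tail_ge (j r c : R) (bad : bool) :
  0 < j -> 1 <= c -> 0 < r -> (bad = true -> c <= r) ->
  log2 c * (j * ind bad) <= plog j r + 2 * (j / r).
Proof.
intros Hj Hc Hr Hb; assert (H := plog_ge j r Hj Hr); assert (L := ln_lt_2).
assert (Hk : 0 < j / r) by (apply Rdiv_lt_0_compat; assumption).
destruct bad; cbn [ind].
- specialize (Hb eq_refl); unfold plog; destruct (Rle_dec j 0); [lra|].
  assert (j * log2 c <= j * log2 r); [|lra].
  apply Rmult_le_compat_l; [lra|apply log2_le; lra].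
- apply Rmult_le_compat_l with (r := ln 2) in H; [|lra].
  replace (ln 2 * ((j - j / r) / ln 2)) with (j - j / r) in H by (field; lra).
  assert (/ 2 * (j / r) <= ln 2 * (j / r)) by (apply Rmult_le_compat_r; lra).
  destruct (Rle_or_lt 0 (plog j r + 2 * (j / r))) as [H1|H1]; [lra|].
  assert (ln 2 * (plog j r + 2 * (j / r)) < 0) by nra. lra.
Qed.

Section Information.
Context {A B I : Type} (lA : list A) (lB : list B) (lI : list I).
Context (mu : A -> B -> R) (qa : I -> A -> R) (qb : I -> B -> R).
Hypothesis mu_nonneg : forall x y, In x lA -> In y lB -> 0 <= mu x y.
Hypothesis qa_nonneg : forall i x, In i lI -> 0 <= qa i x.
Hypothesis qb_nonneg : forall i y, In i lI -> 0 <= qb i y.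
Hypothesis mu_total : lsum lB (fun y => lsum lA (fun x => mu x y)) = 1.
Hypothesis q_total : forall x y, lsum lI (fun i => qa i x * qb i y) = 1.

Definition joint x y i : R := mu x y * (qa i x * qb i y).
Definition margB y : R := lsum lA (fun x => mu x y).
Definition margBI y i : R := lsum lA (fun x => joint x y i).
(** The conditional mutual information of [x] and [i] given [y]. Lists and factors are abstract, so
    that exchanging the parties yields the other term of [IC]. *)
Definition cond_info : R :=
  lsum lB (fun y => lsum lA (fun x => lsum lI (fun i =>
    plog (joint x y i) (joint x y i * margB y / (mu x y * margBI y i))))).

(** The receiver's estimate of the factor [qa i x], given only [y]. *)
Definition guess y i : R := lsum lA (fun x => mu x y * qa i x) / margB y.

Definition mass (F : A -> B -> I -> R) : R :=
  lsum lB (fun y => lsum lA (fun x => lsum lI (fun i => F x y i))).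

Lemma mass_le F G :
  (forall x y i, In x lA -> In y lB -> In i lI -> F x y i <= G x y i) -> mass F <= mass G.
Proof. intros H; do 3 (apply lsum_le; intros ? ?); apply H; assumption. Qed.

Lemma joint_nonneg x y i : In x lA -> In y lB -> In i lI -> 0 <= joint x y i.
Proof. intros; repeat apply Rmult_le_pos; auto. Qed.

Lemma mass_joint : mass joint = 1.
Proof.
rewrite <- mu_total; apply lsum_ext; intros y _; apply lsum_ext; intros x _.
unfold joint; rewrite lsum_scal, q_total; ring.
Qed.

Lemma margB_nonneg y : In y lB -> 0 <= margB y.
Proof. intros; apply lsum_nonneg; auto. Qed.

Lemma margBI_nonneg y i : In y lB -> In i lI -> 0 <= margBI y i.
Proof. intros; apply lsum_nonneg; intros; apply joint_nonneg; assumption. Qed.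

Lemma ref_nonneg x y i : In x lA -> In y lB -> In i lI -> 0 <= mu x y * (margBI y i / margB y).
Proof.
intros Hx Hy Hi; apply Rmult_le_pos; [auto|].
apply Rmult_le_pos; [apply margBI_nonneg; assumption|].
destruct (margB_nonneg y Hy) as [H|H]; [left; apply Rinv_0_lt_compat, H|].
rewrite <- H, Rinv_0; lra.
Qed.

(** The reference measure makes [x] and [i] independent given [y] and preserves the law of [(y, i)].
    Where [margB y = 0] only [0 <= margBI y i] is used, hence an inequality. *)
Lemma mass_ref_le : mass (fun x y i => mu x y * (margBI y i / margB y)) <= 1.
Proof.
rewrite <- mass_joint; apply lsum_le; intros y Hy.
rewrite lsum_swap, (lsum_swap _ _ lA); apply lsum_le; intros i Hi.
rewrite lsum_scal_r; fold (margB y); fold (margBI y i).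
destruct (Req_dec (margB y) 0) as [E|E].
- rewrite E; assert (H := margBI_nonneg y i Hy Hi); lra.
- right; field; exact E.
Qed.

Lemma positive_of_joint x y i :
  In x lA -> In y lB -> In i lI -> 0 < joint x y i ->
  0 < mu x y /\ 0 < margB y /\ 0 < margBI y i /\ 0 < qb i y.
Proof.
intros Hx Hy Hi H.
assert (Hm := mu_nonneg x y Hx Hy); assert (Ha := qa_nonneg i x Hi);
assert (Hb := qb_nonneg i y Hi).
assert (Hm' : 0 < mu x y).
{ destruct Hm as [Hm|Hm]; [exact Hm|]. unfold joint in H; rewrite <- Hm in H; lra. }
repeat split; [exact Hm'| | |].
- apply Rlt_le_trans with (1 := Hm'), (lsum_term_le _ lA (fun x => mu x y)); auto.
- apply Rlt_le_trans with (1 := H), (lsum_term_le _ lA (fun x => joint x y i));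
    [intros; apply joint_nonneg|]; assumption.
- destruct Hb as [Hb|Hb]; [exact Hb|]. unfold joint in H; rewrite <- Hb in H; lra.
Qed.

(** The factor [qb i y] does not depend on [x] and leaves the sum. Hence the ratio inside
    [cond_info] reduces to [qa i x / guess y i]. *)
Lemma margBI_guess y i : margB y <> 0 -> margBI y i = margB y * (guess y i * qb i y).
Proof.
intros H; unfold margBI, joint, guess.
rewrite (lsum_ext _ lA _ (fun x => mu x y * qa i x * qb i y)) by (intros; ring).
rewrite lsum_scal_r; field; exact H.
Qed.

(** Gibbs' inequality: [plog_ge] pointwise, then the joint mass is 1 and the reference mass at most
    1. *)
Lemma cond_info_nonneg : 0 <= cond_info.
Proof.
assert (L := ln_lt_2).
assert (Hi2 : 0 < / ln 2) by (apply Rinv_0_lt_compat; lra).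
apply Rle_trans with (mass (fun x y i =>
  / ln 2 * (joint x y i - mu x y * (margBI y i / margB y)))).
- assert (E : mass (fun x y i => / ln 2 * (joint x y i - mu x y * (margBI y i / margB y)))
     = / ln 2 * (mass joint - mass (fun x y i => mu x y * (margBI y i / margB y)))).
  { unfold mass; rewrite <- lsum_minus, <- lsum_scal; apply lsum_ext; intros y _.
    rewrite <- lsum_minus, <- lsum_scal; apply lsum_ext; intros x _.
    rewrite <- lsum_minus, <- lsum_scal; reflexivity. }
  rewrite E, mass_joint; assert (H := mass_ref_le); apply Rmult_le_pos; lra.
- apply mass_le; intros x y i Hx Hy Hi; destruct (joint_nonneg x y i Hx Hy Hi) as [H|H].
  + destruct (positive_of_joint x y i Hx Hy Hi H) as [H1 [H2 [H3 _]]].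
    assert (Hr : 0 < joint x y i * margB y / (mu x y * margBI y i))
      by (apply Rdiv_lt_0_compat; apply Rmult_lt_0_compat; assumption).
    apply Rle_trans with (2 := plog_ge _ _ H Hr).
    right; field; repeat split; lra.
  + assert (H1 := ref_nonneg x y i Hx Hy Hi).
    unfold plog; destruct (Rle_dec (joint x y i) 0); [nra|lra].
Qed.

(* Markov's inequality for the log-likelihood ratio; its negative part costs at
   most [1 / ln 2 < 2]. *)
Lemma cond_info_tail (c : R) : 1 <= c ->
  log2 c * mass (fun x y i => joint x y i * ind (negb (leb (qa i x) (c * guess y i))))
  <= cond_info + 2.
Proof.
intros Hc.
apply Rle_trans with (cond_info + 2 * mass (fun x y i => mu x y * (margBI y i / margB y)));
  [|assert (H := mass_ref_le); lra].
assert (E : cond_info + 2 * mass (fun x y i => mu x y * (margBI y i / margB y)) =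
  mass (fun x y i => plog (joint x y i) (joint x y i * margB y / (mu x y * margBI y i)) +
                     2 * (mu x y * (margBI y i / margB y)))).
{ unfold cond_info, mass; rewrite <- lsum_scal, <- lsum_plus; apply lsum_ext; intros y _.
  rewrite <- lsum_scal, <- lsum_plus; apply lsum_ext; intros x _.
  rewrite <- lsum_scal, <- lsum_plus; reflexivity. }
rewrite E; apply Rle_trans with (mass (fun x y i =>
  log2 c * (joint x y i * ind (negb (leb (qa i x) (c * guess y i)))))).
- right; unfold mass; do 2 (rewrite <- lsum_scal; apply lsum_ext; intros ? _).
  rewrite <- lsum_scal; reflexivity.
- apply mass_le; intros x y i Hx Hy Hi; destruct (joint_nonneg x y i Hx Hy Hi) as [H|H].
  + destruct (positive_of_joint x y i Hx Hy Hi H) as [H1 [H2 [H3 H4]]].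
    (* The reference mass is the [j / r] of [plog_tail_ge]. *)
    replace (mu x y * (margBI y i / margB y))
      with (joint x y i / (joint x y i * margB y / (mu x y * margBI y i)))
      by (field; repeat split; lra).
    apply plog_tail_ge; [exact H|exact Hc| |].
    * apply Rdiv_lt_0_compat; apply Rmult_lt_0_compat; assumption.
    * intros Hb; unfold leb in Hb.
      destruct (Rle_dec (qa i x) (c * guess y i)) as [|N]; [discriminate|].
      rewrite margBI_guess in * by lra.
      assert (Hg : 0 < guess y i).
      { destruct (Rle_or_lt (guess y i) 0) as [G|G]; [|exact G]. exfalso.
        assert (guess y i * qb i y <= 0) by nra. nra. }
      replace (joint x y i * margB y / (mu x y * (margB y * (guess y i * qb i y))))
        with (qa i x / guess y i) by (unfold joint; field; repeat split; lra).
      apply Rmult_le_reg_r with (guess y i); [exact Hg|].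
      replace (qa i x / guess y i * guess y i) with (qa i x) by (field; lra). lra.
  + assert (H1 := ref_nonneg x y i Hx Hy Hi).
    unfold plog; rewrite <- H; destruct (Rle_dec 0 0); lra.
Qed.

(** Averaging the laws of [i] over [x] given [y] gives a probability distribution; if [margB y = 0],
    the guess is 0 because [/ 0 = 0]. *)
Lemma guess_total y : lsum lI (fun i => qb i y * guess y i) <= 1.
Proof.
destruct (Req_dec (margB y) 0) as [E|E].
- rewrite (lsum_ext _ lI _ (fun _ => 0)), lsum_0; [lra|].
  intros i _; unfold guess, Rdiv; rewrite E, Rinv_0; ring.
- right; apply Rmult_eq_reg_l with (margB y); [|exact E].
  rewrite <- lsum_scal, (lsum_ext _ lI _ (fun i => margBI y i)).
  + unfold margBI; rewrite lsum_swap; unfold margB; rewrite <- lsum_scal_r.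
    apply lsum_ext; intros x _; unfold joint; rewrite lsum_scal, q_total; reflexivity.
  + intros i _; rewrite margBI_guess by exact E; ring.
Qed.

Lemma guess_nonneg y i : In y lB -> In i lI -> 0 <= guess y i.
Proof.
intros Hy Hi; apply Rmult_le_pos.
- apply lsum_nonneg; intros x Hx; apply Rmult_le_pos; auto.
- destruct (margB_nonneg y Hy) as [H|H]; [left; apply Rinv_0_lt_compat, H|].
  rewrite <- H, Rinv_0; lra.
Qed.

End Information.

(** * Leaves of a protocol tree *)

(** Names the inner loop of [runs] and [paths]. [F] stays outside the [fix], so that the guard
    condition lets [leaves] recurse through it. *)
Definition imap_cat {A B : Type} (F : nat -> A -> list B) : list A -> nat -> list B :=
  fix go l i := match l with [] => [] | a :: l' => F i a ++ go l' (S i) end.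

Lemma lsum_imap_cat A B (F : nat -> A -> list B) g h l i :
  (forall j a, In a l -> lsum (F j a) g = h a) -> lsum (imap_cat F l i) g = lsum l h.
Proof.
revert i; induction l as [|a l IH]; intros i H; [reflexivity|].
cbn [imap_cat]; rewrite lsum_app, lsum_cons, H, IH; [reflexivity| |left; reflexivity].
intros j b Hb; apply H; right; exact Hb.
Qed.

Lemma map_imap_cat A B C (phi : B -> C) (F : nat -> A -> list B) G l i :
  (forall j a, In a l -> map phi (F j a) = G j a) ->
  map phi (imap_cat F l i) = imap_cat G l i.
Proof.
revert i; induction l as [|a l IH]; intros i H; [reflexivity|].
cbn [imap_cat]; rewrite map_app, H, IH; [reflexivity| |left; reflexivity].
intros j b Hb; apply H; right; exact Hb.
Qed.

Lemma in_imap_cat A B (F : nat -> A -> list B) b l i :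
  In b (imap_cat F l i) -> exists j a, (i <= j)%nat /\ In a l /\ In b (F j a).
Proof.
revert i; induction l as [|a l IH]; intros i H; [destruct H|].
cbn [imap_cat] in H; apply in_app_iff in H as [H|H].
- exists i, a; split; [lia|]; split; [left; reflexivity|exact H].
- destruct (IH _ H) as [j [a' [H1 [H2 H3]]]].
  exists j, a'; split; [lia|]; split; [right|]; assumption.
Qed.

(** Paths through different children differ in their first index. *)
Lemma NoDup_imap_cat A (P : A -> list (list nat)) l i :
  (forall a, In a l -> NoDup (P a)) -> NoDup (imap_cat (fun j a => map (cons j) (P a)) l i).
Proof.
revert i; induction l as [|a l IH]; intros i H; [constructor|].
cbn [imap_cat]; apply NoDup_app.
- apply NoDup_map_NoDup_ForallPairs; [|apply H; left; reflexivity].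
  intros u v _ _ E; injection E; auto.
- apply IH; intros b Hb; apply H; right; exact Hb.
- intros t Ht Ht'; apply in_map_iff in Ht as [u [<- _]].
  apply in_imap_cat in Ht' as [j [b [Hj [_ Hb]]]].
  apply in_map_iff in Hb as [v [E _]]; injection E; intros; lia.
Qed.

(** The probability of a transcript is a product of a function of [x] and a
    function of [y]; the public coins are charged to Alice. *)
Record leaf (X Y Z : Type) : Type :=
  Leaf { path : list nat; wA : X -> R; wB : Y -> R; out : Z }.
Arguments Leaf {X Y Z}.
Arguments path {X Y Z}.
Arguments wA {X Y Z}.
Arguments wB {X Y Z}.
Arguments out {X Y Z}.

Section Leaves.
Context {X Y Z : Type}.

Definition below (i : nat) (u : X -> R) (v : Y -> R) (e : leaf X Y Z) : leaf X Y Z :=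
  Leaf (i :: path e) (fun x => u x * wA e x)
    (fun y => v y * wB e y) (out e).

Fixpoint leaves (p : proto X Y Z) : list (leaf X Y Z) :=
  match p with
  | PLeaf z => [Leaf [] (fun _ => 1) (fun _ => 1) z]
  | PAlice l => imap_cat (fun i c => map (below i (fst c) (fun _ => 1)) (leaves (snd c))) l 0
  | PBob l => imap_cat (fun i c => map (below i (fun _ => 1) (fst c)) (leaves (snd c))) l 0
  | PPub l => imap_cat (fun i c => map (below i (fun _ => fst c) (fun _ => 1)) (leaves (snd c))) l 0
  end.

Definition extend (i : nat) (w : R) (e : list nat * R * Z) : list nat * R * Z :=
  (i :: fst (fst e), w * snd (fst e), snd e).

Lemma runs_PAlice (l : list ((X -> R) * proto X Y Z)) x y : runs (PAlice l) x y =
  imap_cat (fun i c => map (extend i (fst c x)) (runs (snd c) x y)) l 0.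
Proof.
cbn [runs]; generalize 0%nat; induction l as [|[w q] l IH]; intros i; [reflexivity|].
cbn [imap_cat fst snd]; rewrite IH; reflexivity.
Qed.

Lemma runs_PBob (l : list ((Y -> R) * proto X Y Z)) x y : runs (PBob l) x y =
  imap_cat (fun i c => map (extend i (fst c y)) (runs (snd c) x y)) l 0.
Proof.
cbn [runs]; generalize 0%nat; induction l as [|[w q] l IH]; intros i; [reflexivity|].
cbn [imap_cat fst snd]; rewrite IH; reflexivity.
Qed.

Lemma runs_PPub (l : list (R * proto X Y Z)) x y : runs (PPub l) x y =
  imap_cat (fun i c => map (extend i (fst c)) (runs (snd c) x y)) l 0.
Proof.
cbn [runs]; generalize 0%nat; induction l as [|[w q] l IH]; intros i; [reflexivity|].
cbn [imap_cat fst snd]; rewrite IH; reflexivity.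
Qed.

Lemma paths_PAlice (l : list ((X -> R) * proto X Y Z)) :
  paths (PAlice l) = imap_cat (fun i (c : _ * proto X Y Z) => map (cons i) (paths (snd c))) l 0.
Proof.
cbn [paths]; generalize 0%nat; induction l as [|[w q] l IH]; intros i; [reflexivity|].
cbn [imap_cat snd]; rewrite IH; reflexivity.
Qed.

Lemma paths_PBob (l : list ((Y -> R) * proto X Y Z)) :
  paths (PBob l) = imap_cat (fun i (c : _ * proto X Y Z) => map (cons i) (paths (snd c))) l 0.
Proof.
cbn [paths]; generalize 0%nat; induction l as [|[w q] l IH]; intros i; [reflexivity|].
cbn [imap_cat snd]; rewrite IH; reflexivity.
Qed.

Lemma paths_PPub (l : list (R * proto X Y Z)) :
  paths (PPub l) = imap_cat (fun i (c : _ * proto X Y Z) => map (cons i) (paths (snd c))) l 0.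
Proof.
cbn [paths]; generalize 0%nat; induction l as [|[w q] l IH]; intros i; [reflexivity|].
cbn [imap_cat snd]; rewrite IH; reflexivity.
Qed.

Definition run_of (x : X) (y : Y) (e : leaf X Y Z) : list nat * R * Z :=
  (path e, wA e x * wB e y, out e).

Lemma map_run_of_below i u v x y (l : list (leaf X Y Z)) :
  map (run_of x y) (map (below i u v) l) =
  map (extend i (u x * v y)) (map (run_of x y) l).
Proof.
rewrite !map_map; apply map_ext; intros e; unfold run_of, extend, below; cbn; f_equal; f_equal; ring.
Qed.

(** Leaves are enumerated in the order of [runs], which makes this an equality of lists. It moves
    the dependence on the input from the list into its entries. *)
Lemma runs_leaves p x y : valid p -> map (run_of x y) (leaves p) = runs p x y.
Proof.
induction 1 as [z|l _ _ _ IH|l _ _ _ IH|l _ _ _ IH].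
- cbn; unfold run_of; cbn; rewrite Rmult_1_r; reflexivity.
- rewrite runs_PAlice; apply map_imap_cat; intros j c Hc.
  rewrite map_run_of_below, IH by exact Hc; rewrite Rmult_1_r; reflexivity.
- rewrite runs_PBob; apply map_imap_cat; intros j c Hc.
  rewrite map_run_of_below, IH by exact Hc; rewrite Rmult_1_l; reflexivity.
- rewrite runs_PPub; apply map_imap_cat; intros j c Hc.
  rewrite map_run_of_below, IH by exact Hc; rewrite Rmult_1_r; reflexivity.
Qed.

Lemma paths_leaves (p : proto X Y Z) : valid p -> map path (leaves p) = paths p.
Proof.
induction 1 as [z|l _ _ _ IH|l _ _ _ IH|l _ _ _ IH]; [reflexivity|..];
  rewrite ?paths_PAlice, ?paths_PBob, ?paths_PPub; apply map_imap_cat; intros j c Hc;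
  rewrite map_map, <- IH, map_map by exact Hc; reflexivity.
Qed.

Lemma paths_NoDup (p : proto X Y Z) : valid p -> NoDup (paths p).
Proof.
induction 1 as [z|l _ _ _ IH|l _ _ _ IH|l _ _ _ IH].
- constructor; [intros []|constructor].
- rewrite paths_PAlice; apply NoDup_imap_cat, IH.
- rewrite paths_PBob; apply NoDup_imap_cat, IH.
- rewrite paths_PPub; apply NoDup_imap_cat, IH.
Qed.

Lemma leaves_total p x y : valid p ->
  lsum (leaves p) (fun e => wA e x * wB e y) = 1.
Proof.
induction 1 as [z|l Hs _ _ IH|l Hs _ _ IH|l Hs _ _ IH].
- unfold lsum; cbn; ring.
- rewrite <- (Hs x); apply lsum_imap_cat; intros j c Hc; rewrite lsum_map.
  transitivity (fst c x * lsum (leaves (snd c)) (fun e => wA e x * wB e y));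
    [|rewrite IH by exact Hc; ring].
  rewrite <- lsum_scal; apply lsum_ext; intros e _; cbn; ring.
- rewrite <- (Hs y); apply lsum_imap_cat; intros j c Hc; rewrite lsum_map.
  transitivity (fst c y * lsum (leaves (snd c)) (fun e => wA e x * wB e y));
    [|rewrite IH by exact Hc; ring].
  rewrite <- lsum_scal; apply lsum_ext; intros e _; cbn; ring.
- rewrite <- Hs; apply lsum_imap_cat; intros j c Hc; rewrite lsum_map.
  transitivity (fst c * lsum (leaves (snd c)) (fun e => wA e x * wB e y));
    [|rewrite IH by exact Hc; ring].
  rewrite <- lsum_scal; apply lsum_ext; intros e _; cbn; ring.
Qed.

Lemma leaves_weights p e : valid p -> In e (leaves p) ->
  (forall x, 0 <= wA e x <= 1) /\ (forall y, 0 <= wB e y <= 1).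
Proof.
intros Hp; revert e.
assert (M : forall u v, 0 <= u <= 1 -> 0 <= v <= 1 -> 0 <= u * v <= 1).
{ intros u v Hu Hv; split; [apply Rmult_le_pos; lra|].
  replace 1 with (1 * 1) by ring; apply Rmult_le_compat; lra. }
induction Hp as [z|l Hs Hn _ IH|l Hs Hn _ IH|l Hs Hn _ IH]; intros e He.
- destruct He as [<-|[]]; cbn; split; intros; lra.
- apply in_imap_cat in He as [j [c [_ [Hc He]]]]; apply in_map_iff in He as [e' [<- He]].
  destruct (IH c Hc e' He) as [H1 H2]; cbn; split; intros; apply M; auto; [|lra].
  split; [apply Hn, Hc|]. rewrite <- (Hs x).
  apply (lsum_term_le _ l (fun c => fst c x)); [intros; apply Hn|]; assumption.
- apply in_imap_cat in He as [j [c [_ [Hc He]]]]; apply in_map_iff in He as [e' [<- He]].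
  destruct (IH c Hc e' He) as [H1 H2]; cbn; split; intros; apply M; auto; [lra|].
  split; [apply Hn, Hc|]. rewrite <- (Hs y).
  apply (lsum_term_le _ l (fun c => fst c y)); [intros; apply Hn|]; assumption.
- apply in_imap_cat in He as [j [c [_ [Hc He]]]]; apply in_map_iff in He as [e' [<- He]].
  destruct (IH c Hc e' He) as [H1 H2]; cbn; split; intros; apply M; auto; [|lra].
  split; [apply Hn, Hc|]. rewrite <- Hs.
  apply (lsum_term_le _ l (fun c => fst c)); [intros; apply Hn|]; assumption.
Qed.

(** Paths are distinct, so a single run contributes to the sum in [Ptr]. *)
Lemma Ptr_leaf p x y e : valid p -> In e (leaves p) ->
  Ptr p x y (path e) = wA e x * wB e y.
Proof.
intros Hp He; unfold Ptr; rewrite <- (runs_leaves p x y Hp), map_map.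
apply (lsum_delta _ _ (list_eq_dec Nat.eq_dec) path (leaves p)
  (fun e => wA e x * wB e y) e); [|exact He].
rewrite paths_leaves by exact Hp; apply paths_NoDup, Hp.
Qed.

End Leaves.

(** * The main bound *)

Lemma sumT_nonempty (T : FinT) (g : T -> R) : sumT T g <> 0 -> inhabited T.
Proof.
unfold sumT; destruct (ft_elems T) as [|t l]; intros H; [elim H; reflexivity|].
exact (inhabits t).
Qed.

Section Protocol.
Context {X Y Z : FinT} (f : X -> Y -> option Z) (mu : X -> Y -> R) (p : proto X Y Z).
Hypothesis mu_dist : is_dist mu.
Hypothesis p_valid : valid p.

Let lX := ft_elems X.
Let lY := ft_elems Y.
Let lP := leaves p.
Let muT (y : Y) (x : X) : R := mu x y.
Let run x y (e : leaf X Y Z) : R := wA e x * wB e y.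

Lemma mu_total_XY : lsum lX (fun x => lsum lY (fun y => mu x y)) = 1.
Proof. exact (proj2 mu_dist). Qed.

Lemma mu_total_YX : lsum lY (fun y => lsum lX (fun x => mu x y)) = 1.
Proof. rewrite lsum_swap; exact mu_total_XY. Qed.

Lemma run_total x y : lsum lP (run x y) = 1.
Proof. exact (leaves_total p x y p_valid). Qed.

Lemma run_total_sym y x : lsum lP (fun e => wB e y * wA e x) = 1.
Proof. rewrite <- (run_total x y); apply lsum_ext; intros e _; apply Rmult_comm. Qed.

Lemma wA_bounds e x : In e lP -> 0 <= wA e x <= 1.
Proof. intros He; apply (leaves_weights p e p_valid He). Qed.

Lemma wB_bounds e y : In e lP -> 0 <= wB e y <= 1.
Proof. intros He; apply (leaves_weights p e p_valid He). Qed.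

(** Transcripts are reindexed by leaves, where their probabilities factor. *)
Lemma MI_X_cond_info : MI_X_T_given_Y mu p = cond_info lX lY lP mu wA wB.
Proof.
unfold cond_info; rewrite lsum_swap; apply lsum_ext; intros x _; apply lsum_ext; intros y _.
unfold sumPaths; rewrite <- paths_leaves by exact p_valid.
change (lsum (map path lP) (fun t => plog (Jnt mu p x y t)
   (Jnt mu p x y t * PY mu y / (mu x y * PYT mu p y t))) =
  lsum lP (fun e => plog (joint mu wA wB x y e)
    (joint mu wA wB x y e * margB lX mu y / (mu x y * margBI lX mu wA wB y e)))); rewrite lsum_map.
apply lsum_ext; intros e He; unfold PYT, Jnt; rewrite Ptr_leaf by assumption.
assert (E : sumT X (fun x => mu x y * Ptr p x y (path e)) = margBI lX mu wA wB y e).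
{ apply lsum_ext; intros x' _; rewrite Ptr_leaf by assumption; reflexivity. }
rewrite E; reflexivity.
Qed.

Lemma MI_Y_cond_info : MI_Y_T_given_X mu p = cond_info lY lX lP muT wB wA.
Proof.
apply lsum_ext; intros x _; apply lsum_ext; intros y _.
unfold sumPaths; rewrite <- paths_leaves by exact p_valid.
change (lsum (map path lP) (fun t => plog (Jnt mu p x y t)
   (Jnt mu p x y t * PX mu x / (mu x y * PXT mu p x t))) =
  lsum lP (fun e => plog (joint muT wB wA y x e)
    (joint muT wB wA y x e * margB lY muT x / (muT y x * margBI lY muT wB wA x e)))); rewrite lsum_map.
apply lsum_ext; intros e He; unfold PXT, Jnt; rewrite Ptr_leaf by assumption.
assert (E : sumT Y (fun y => mu x y * Ptr p x y (path e)) = margBI lY muT wB wA x e).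
{ apply lsum_ext; intros y' _; rewrite Ptr_leaf by assumption.
  unfold joint, muT; ring. }
rewrite E; unfold joint, muT; rewrite (Rmult_comm (wA e x)); reflexivity.
Qed.

(** [guess_A] is Alice's estimate of [wB], and [guess_B] Bob's estimate of [wA]. *)
Let guess_A (e : leaf X Y Z) (x : X) : R := guess lY muT wB x e.
Let guess_B (e : leaf X Y Z) (y : Y) : R := guess lX mu wA y e.
(** A sum of indicators in place of a disjunction: it splits linearly into the two tail bounds, and
    the value 2 does no harm in an upper bound on the loss. *)
Let bad (c : R) x y (e : leaf X Y Z) : R :=
  ind (negb (leb (wA e x) (c * guess_B e y))) + ind (negb (leb (wB e y) (c * guess_A e x))).

Lemma IC_nonneg : 0 <= IC mu p.
Proof.
destruct mu_dist as [Hmu _].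
unfold IC; rewrite MI_X_cond_info, MI_Y_cond_info; apply Rplus_le_le_0_compat;
  apply cond_info_nonneg; intros; try apply Hmu; try (apply wA_bounds; assumption);
  try (apply wB_bounds; assumption).
- exact mu_total_YX.
- apply run_total.
- exact mu_total_XY.
- apply run_total_sym.
Qed.

(** Adds the two tail bounds, one for each party; each contributes 2 to the constant. *)
Lemma IC_tail (c : R) : 1 <= c ->
  log2 c * lsum lX (fun x => lsum lY (fun y =>
    mu x y * lsum lP (fun e => run x y e * bad c x y e))) <= IC mu p + 4.
Proof.
intros Hc; destruct mu_dist as [Hmu _].
assert (H1 : log2 c * mass lX lY lP (fun x y e =>
    joint mu wA wB x y e * ind (negb (leb (wA e x) (c * guess_B e y)))) <=
    MI_X_T_given_Y mu p + 2).
{ rewrite MI_X_cond_info; apply cond_info_tail; try exact Hc; intros; try apply Hmu;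
  try (apply wA_bounds; assumption); try (apply wB_bounds; assumption).
  - exact mu_total_YX.
  - apply run_total. }
assert (H2 : log2 c * mass lY lX lP (fun y x e =>
    joint muT wB wA y x e * ind (negb (leb (wB e y) (c * guess_A e x)))) <=
    MI_Y_T_given_X mu p + 2).
{ rewrite MI_Y_cond_info; apply cond_info_tail; try exact Hc; intros; try apply Hmu;
  try (apply wA_bounds; assumption); try (apply wB_bounds; assumption).
  - exact mu_total_XY.
  - apply run_total_sym. }
unfold IC.
replace (MI_X_T_given_Y mu p + MI_Y_T_given_X mu p + 4)
  with (MI_X_T_given_Y mu p + 2 + (MI_Y_T_given_X mu p + 2)) by ring.
apply Rle_trans with (2 := Rplus_le_compat _ _ _ _ H1 H2).
rewrite <- Rmult_plus_distr_l; right; f_equal; unfold mass.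
rewrite (lsum_swap _ _ lY lX), <- lsum_plus; apply lsum_ext; intros x _.
rewrite <- lsum_plus; apply lsum_ext; intros y _.
rewrite <- lsum_plus, <- lsum_scal; apply lsum_ext; intros e _.
unfold joint, bad, run, muT; ring.
Qed.

Lemma err_pt_leaves x y z : f x y = Some z ->
  err_pt f p x y = lsum lP (fun e => if ft_dec Z (out e) z then 0 else run x y e).
Proof.
intros E; unfold err_pt; rewrite E, <- (runs_leaves p x y p_valid), map_map; reflexivity.
Qed.

(* Whenever neither factor exceeds [c] times the other party's guess, the two
   truncations are inactive and the rectangle family reproduces the transcript
   probability exactly. *)
Lemma simulation (c : R) : 1 <= c ->
  exists U : list (rz_entry X Y Z),
    (forall u, In u U -> 0 <= wt u <= 1) /\
    (forall x, lsum U (fun u => wt u * ind (side_X u x)) <= c) /\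
    (forall y, lsum U (fun u => wt u * ind (side_Y u y)) <= c) /\
    (forall x y, cover_all U x y <= 1) /\
    1 - err f p mu - lsum lX (fun x => lsum lY (fun y =>
      mu x y * lsum lP (fun e => run x y e * bad c x y e))) <= success f mu U.
Proof.
intros Hc; destruct mu_dist as [Hmu _].
assert (HgA : forall e x, In e lP -> 0 <= guess_A e x).
{ intros e x He; apply (guess_nonneg _ lX lP); try apply ft_full; try exact He; intros;
  try apply Hmu; apply wB_bounds; assumption. }
assert (HgB : forall e y, In e lP -> 0 <= guess_B e y).
{ intros e y He; apply (guess_nonneg _ lY lP); try apply ft_full; try exact He; intros;
  try apply Hmu; apply wA_bounds; assumption. }
(* [threshold_family] requires values in [[0, 1]]; capping at 1 loses nothing, as the factors
   compared with the caps are at most 1. *)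
assert (Hcap : forall r, 0 <= r -> 0 <= Rmin 1 (c * r) <= 1).
{ intros r Hr; split; [|apply Rmin_l]. apply Rmin_glb; [lra|apply Rmult_le_pos; lra]. }
destruct (threshold_family lP wA (fun e x => Rmin 1 (c * guess_A e x))
  wB (fun e y => Rmin 1 (c * guess_B e y)) out) as [U [HU [HX [HY HZ]]]].
{ intros; apply wA_bounds; assumption. }
{ intros; apply Hcap, HgA; assumption. }
{ intros; apply wB_bounds; assumption. }
{ intros; apply Hcap, HgB; assumption. }
set (acc := fun x y e => Rmin (wA e x) (Rmin 1 (c * guess_B e y))
                       * Rmin (Rmin 1 (c * guess_A e x)) (wB e y)).
assert (Hacc : forall x y e, In e lP ->
  run x y e - run x y e * bad c x y e <= acc x y e <= run x y e /\ 0 <= acc x y e).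
{ intros x y e He; unfold acc, run, bad, leb.
  assert (A := wA_bounds e x He); assert (B := wB_bounds e y He).
  assert (CA := Hcap _ (HgA e x He)); assert (CB := Hcap _ (HgB e y He)).
  assert (0 <= Rmin (wA e x) (Rmin 1 (c * guess_B e y))) by (apply Rmin_glb; lra).
  assert (0 <= Rmin (Rmin 1 (c * guess_A e x)) (wB e y)) by (apply Rmin_glb; lra).
  assert (Rmin (wA e x) (Rmin 1 (c * guess_B e y)) <= wA e x) by apply Rmin_l.
  assert (Rmin (Rmin 1 (c * guess_A e x)) (wB e y) <= wB e y) by apply Rmin_r.
  assert (0 <= wA e x * wB e y) by (apply Rmult_le_pos; lra).
  split; [split|]; [|apply Rmult_le_compat; assumption|apply Rmult_le_pos; assumption].
  (* In all cases but the first [bad] is at least 1, so the left side is at most 0. *)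
  destruct (Rle_dec (wA e x) (c * guess_B e y)) as [G1|G1],
    (Rle_dec (wB e y) (c * guess_A e x)) as [G2|G2]; cbn [negb ind];
    try (apply Rle_trans with 0; [lra|apply Rmult_le_pos; assumption]).
  rewrite (Rmin_left (wA e x)) by (apply Rmin_glb; lra).
  rewrite (Rmin_right _ (wB e y)) by (apply Rmin_glb; lra). lra. }
assert (Hall : forall x y, cover_all U x y = lsum lP (acc x y)).
{ intros x y; rewrite cover_all_sum_z, (lsum_ext _ _ _ _ (fun z _ => HZ x y z)), lsum_swap.
  apply lsum_ext; intros e _; apply (lsum_delta_FinT Z (fun _ => acc x y e)). }
exists U; split; [exact HU|]; split; [|split; [|split]].
- intros x; rewrite HX; apply Rle_trans with (c * lsum lP (fun e => wA e x * guess_A e x)).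
  + rewrite <- lsum_scal; apply lsum_le; intros e He.
    assert (A := wA_bounds e x He).
    replace (c * (wA e x * guess_A e x)) with (wA e x * (c * guess_A e x)) by ring.
    apply Rmult_le_compat_l; [lra|apply Rmin_r].
  + rewrite <- (Rmult_1_r c) at 2; apply Rmult_le_compat_l; [lra|].
    apply guess_total, run_total_sym.
- intros y; rewrite HY; apply Rle_trans with (c * lsum lP (fun e => wB e y * guess_B e y)).
  + rewrite <- lsum_scal; apply lsum_le; intros e He.
    assert (B := wB_bounds e y He); rewrite (Rmult_comm _ (wB e y)).
    replace (c * (wB e y * guess_B e y)) with (wB e y * (c * guess_B e y)) by ring.
    apply Rmult_le_compat_l; [lra|apply Rmin_r].
  + rewrite <- (Rmult_1_r c) at 2; apply Rmult_le_compat_l; [lra|].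
    apply guess_total, run_total.
- intros x y; rewrite Hall, <- (run_total x y); apply lsum_le; intros e He; apply Hacc, He.
- rewrite <- mu_total_XY at 1.
  change (err f p mu) with (lsum lX (fun x => lsum lY (fun y => mu x y * err_pt f p x y))).
  rewrite <- !lsum_minus; apply lsum_le; intros x _.
  rewrite <- !lsum_minus; apply lsum_le; intros y _.
  set (b := lsum lP (fun e => run x y e * bad c x y e)).
  replace (mu x y - mu x y * err_pt f p x y - mu x y * b)
    with (mu x y * (1 - err_pt f p x y - b)) by ring.
  apply Rmult_le_compat_l; [apply Hmu|].
  rewrite <- (run_total x y); unfold b; destruct (f x y) as [z|] eqn:E.
  (* A leaf with the wrong output is charged to the error, any other loss to [bad]. *)
  + rewrite (err_pt_leaves x y z E), <- !lsum_minus, HZ; apply lsum_le; intros e He.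
    destruct (Hacc x y e He) as [[H1 _] _].
    assert (A := wA_bounds e x He); assert (B := wB_bounds e y He).
    assert (0 <= run x y e) by (apply Rmult_le_pos; lra).
    assert (0 <= bad c x y e) by (apply Rplus_le_le_0_compat; apply ind_bounds).
    assert (0 <= run x y e * bad c x y e) by (apply Rmult_le_pos; assumption).
    destruct (ft_dec Z (out e) z); [unfold acc in H1|]; lra.
  (* Off the promise every output counts as a success and the error is 0. *)
  + unfold err_pt; rewrite E, Rminus_0_r, <- lsum_minus, Hall; apply lsum_le; intros e He.
    apply Hacc, He.
Qed.

(** Total mass 1 forces an input pair to exist, then a leaf, whose output lies in [Z]. *)
Lemma card_output_pos : 0 < card Z.
Proof.
destruct (sumT_nonempty X (fun x => sumT Y (fun y => mu x y))) as [x];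
  [rewrite (proj2 mu_dist); lra|].
destruct (sumT_nonempty Y (fun y => lsum lX (fun x => mu x y))) as [y].
{ change (sumT Y) with (lsum lY); rewrite mu_total_YX; lra. }
assert (H := run_total x y); unfold lP in *; destruct (leaves p) as [|e l].
- rewrite lsum_nil in H; lra.
- unfold card; assert (Hz := ft_full Z (out e)); destruct (ft_elems Z) as [|z zs]; [destruct Hz|].
  apply lt_0_INR; cbn; lia.
Qed.

End Protocol.

(** * Logarithm estimates and the choice of constants *)

Lemma log2_mult a b : 0 < a -> 0 < b -> log2 (a * b) = log2 a + log2 b.
Proof. intros Ha Hb; unfold log2; rewrite ln_mult by assumption; unfold Rdiv; ring. Qed.

(** A crude bound suffices: the prefactor [delta ^ 2] turns [2 / delta] into a multiple of
    [delta]. *)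
Lemma log2_inv_le d : 0 < d -> log2 (/ d) <= 2 / d.
Proof.
intros Hd; assert (L := ln_lt_2); assert (H := ln_ge d Hd).
assert (Hi : 0 < / d) by (apply Rinv_0_lt_compat, Hd).
unfold log2; rewrite ln_Rinv by exact Hd.
apply Rmult_le_reg_r with (ln 2); [lra|].
unfold Rdiv; rewrite Rmult_assoc, Rinv_l by lra. nra.
Qed.

Theorem theorem1 :
  exists C : R, 0 < C /\
  forall (X Y Z : FinT) (f : X -> Y -> option Z) (eps delta : R),
    0 < eps <= 1 / 2 -> 0 < delta <= 1 / 2 ->
    forall mu : X -> Y -> R, is_dist mu ->
    forall prt : R, is_inf (prt_vals f mu (eps + 3 * delta)) prt ->
    (* IC_mu(f, eps) >= bound, i.e. every protocol with error <= eps has IC >= bound *)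
    forall pi : proto X Y Z, valid pi -> err f pi mu <= eps ->
      IC mu pi >= delta ^ 2 / C * (log2 prt - log2 (card Z)) - delta.
Proof.
(* With [k * delta = IC + 4], the bound [2 * k + 2 / delta] times [delta ^ 2 / 10] is
   [delta * IC / 5 + delta]; the constant 10 makes the additive part exactly [delta]. *)
exists 10; split; [lra|].
intros X Y Z f eps delta Heps Hd mu Hmu prt [Hprt _] p Hp Herr.
assert (Hic := IC_nonneg mu p Hmu Hp); assert (HZ := card_output_pos mu p Hmu Hp).
assert (L := ln_lt_2).
set (k := (IC mu p + 4) / delta).
assert (Hkd : k * delta = IC mu p + 4) by (unfold k; field; lra).
assert (Hk : 0 < k) by (apply Rdiv_lt_0_compat; lra).
(* That is, [c] is 2 to the power [k], so that [IC_tail] bounds the bad mass by [delta]. *)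
set (c := exp (k * ln 2)).
assert (Hkl : 0 < k * ln 2) by (apply Rmult_lt_0_compat; lra).
assert (Hc : 1 <= c) by (assert (H := exp_ineq1_le (k * ln 2)); unfold c; lra).
assert (Hlc : log2 c = k) by (unfold log2, c; rewrite ln_exp; field; lra).
assert (Htail := IC_tail mu p Hmu Hp c Hc); rewrite Hlc, <- Hkd in Htail.
apply Rmult_le_reg_l in Htail; [|exact Hk].
destruct (simulation f mu p Hmu Hp c Hc) as [U [HU [HX [HY [Hcov Hsucc]]]]].
(* The success is at least [1 - eps - delta], which is [1 - e + 2 * d] for [e = eps + 3 * delta] and
   [d = delta]. *)
assert (Hfeas := hitting_feasible U f mu c delta (eps + 3 * delta) HZ Hmu Hc
  ltac:(lra) ltac:(lra) HU HX HY Hcov ltac:(lra)).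
assert (Hle := Hprt _ (ex_intro _ _ (ex_intro _ _ (conj Hfeas eq_refl)))).
assert (Hid : 0 < / delta) by (apply Rinv_0_lt_compat; lra).
assert (Hup : prt <= card Z * (c * c * / delta)).
{ apply Rle_trans with (1 := Hle).
  replace (/ (/ card Z * (delta / (c * c) * (1 + delta))))
    with (card Z * (c * c * / delta) * / (1 + delta)) by (field; lra).
  rewrite <- (Rmult_1_r (card Z * (c * c * / delta))) at 2.
  apply Rmult_le_compat_l; [repeat apply Rmult_le_pos; lra|].
  rewrite <- Rinv_1; apply Rinv_le_contravar; lra. }
assert (Hlog : log2 (card Z * (c * c * / delta)) <= log2 (card Z) + (2 * k + 2 / delta)).
{ rewrite !log2_mult by (try apply Rmult_lt_0_compat; nra).
  rewrite Hlc; assert (H := log2_inv_le delta ltac:(lra)); lra. }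
assert (Hmain : log2 prt - log2 (card Z) <= 2 * k + 2 / delta).
{ destruct (Rlt_or_le 0 prt) as [H0|H0].
  - apply Rle_trans with (log2 (card Z * (c * c * / delta)) - log2 (card Z)); [|lra].
    apply Rplus_le_compat_r, log2_le; assumption.
  - (* Junk value: [ln prt = 0] for [prt <= 0]. *)
    assert (E : log2 prt = 0).
    { assert (E : ln prt = 0) by (unfold ln; destruct (Rlt_dec 0 prt); [exfalso; lra|reflexivity]).
      unfold log2; rewrite E; unfold Rdiv; ring. }
    assert (0 <= log2 (card Z)).
    { rewrite <- log2_1; apply log2_le; [lra|].
      apply (le_INR 1), INR_lt; exact HZ. }
    assert (0 < 2 / delta) by (apply Rdiv_lt_0_compat; lra). lra. }
apply Rle_ge, Rle_trans with (delta ^ 2 / 10 * (2 * k + 2 / delta) - delta).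
- apply Rplus_le_compat_r, Rmult_le_compat_l; [nra|exact Hmain].
- replace (delta ^ 2 / 10 * (2 * k + 2 / delta)) with (delta / 5 * (k * delta) + delta / 5)
    by (field; lra).
  rewrite Hkd; nra.
Qed.
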